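(* Let $\alpha\in\mathbb{R}$ and let $X=\{\sqrt{n}\,e^{2\pi i\alpha n} : n\in\mathbb{N}\}\subseteq\mathbb{C}\cong\mathbb{R}^2$ be the Fermat spiral with angle difference $\alpha$. Then every non-empty Chabauty limit of $X$ is a translate of a closed subgroup of $\mathbb{R}^2$.
   Context: The Chabauty–Fell topology on the set of closed subsets of $\mathbb{R}^d$ is given by the metric $d(A,B)=\min\{1,\Delta(A,B)\}$, where $\Delta(A,B)=\inf\{\epsilon>0 : B_{1/\epsilon}(0)\cap A\subseteq\mathcal{N}_\epsilon(B),\ B_{1/\epsilon}(0)\cap B\subseteq\mathcal{N}_\epsilon(A)\}$, $\mathcal{N}_\epsilon(A)=\bigcup_{x\in A}B_\epsilon(x)$, and $B_r(x)$ is the Euclidean ball. A Chabauty limit of a closed set $X\subseteq\mathbb{R}^d$ is the limit (if it exists), in this topology, of $T_nX$ for a sequence $T_n$ of translations of $\mathbb{R}^d$ with $T_n(0)\to\infty$. *)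

(* Defs.v *)
(* MathComp-Analysis, over an arbitrary [R : realType]. *)
From HB Require Import structures.
From mathcomp Require Import all_boot all_order all_algebra.
From mathcomp Require Import all_classical all_reals all_analysis.
From mathcomp Require Import complex.

Set Implicit Arguments.
Unset Strict Implicit.
Unset Printing Implicit Defensive.

Import Order.TTheory GRing.Theory Num.Theory.
Import numFieldNormedType.Exports.

Local Open Scope classical_set_scope.
Local Open Scope ring_scope.

(* The library's norm and [ball] on ['rV[R]_d] are those of the sup norm, hence
   the separate Euclidean versions below; the topology (and so [closed]) is the
   same for both. *)
Definition eucl_norm (R : realType) (d : nat) (x : 'rV[R]_d) : R :=
  Num.sqrt (\sum_(i < d) x 0 i ^+ 2).

Definition eucl_ball (R : realType) (d : nat) (x : 'rV[R]_d) (r : R) :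
  set 'rV[R]_d := [set y | eucl_norm (y - x) < r].

Definition nbhd (R : realType) (d : nat) (e : R) (A : set 'rV[R]_d) :
  set 'rV[R]_d := \bigcup_(x in A) eucl_ball x e.

(* The infimum is taken in the extended reals: there may be no admissible [e]
   (for instance when [0 \in A] and [B] is empty), and then it is [+oo]. *)
Definition chabauty_Delta (R : realType) (d : nat) (A B : set 'rV[R]_d) :
  \bar R :=
  ereal_inf [set e%:E | e in [set e : R | [/\ 0 < e,
    eucl_ball 0 e^-1 `&` A `<=` nbhd e B &
    eucl_ball 0 e^-1 `&` B `<=` nbhd e A]]].

(* The minimum lies in [0, 1], so [fine] loses no information. *)
Definition chabauty_dist (R : realType) (d : nat) (A B : set 'rV[R]_d) : R :=
  fine (Order.min 1%:E (chabauty_Delta A B)).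

(* [shift (t n)] is the translation [x |-> x + t n]. *)
Definition chabauty_limit (R : realType) (d : nat) (X L : set 'rV[R]_d) : Prop :=
  closed L /\
  exists t : nat -> 'rV[R]_d,
    eucl_norm (shift (t n) 0) @[n --> \oo] --> +oo /\
    chabauty_dist (shift (t n) @` X) L @[n --> \oo] --> (0 : R).

Definition closed_subgroup (R : realType) (d : nat) (G : set 'rV[R]_d) : Prop :=
  closed G /\ zmod_closed [in G].

Definition plane_of_complex (R : realType) (z : R[i]) : 'rV[R]_2 :=
  \row_(j < 2) if j == 0 then complex.Re z else complex.Im z.

(* [cexpi t] is the complex exponential of [i t]. *)
Definition cexpi (R : realType) (t : R) : R[i] := (cos t +i* sin t)%C.

Definition fermat_spiral (R : realType) (alpha : R) : set 'rV[R]_2 :=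
  [set plane_of_complex ((Num.sqrt n%:R)%:C%C * cexpi (2 * pi * alpha * n%:R))
     | n in [set: nat]].

(* Main.v *)
Require Import Defs.
From HB Require Import structures.
From mathcomp Require Import all_boot all_order all_algebra.
From mathcomp Require Import all_classical all_reals all_analysis.
From mathcomp Require Import complex.
From mathcomp Require Import ring lra.

Set Implicit Arguments.
Unset Strict Implicit.
Unset Printing Implicit Defensive.

Import Order.TTheory GRing.Theory Num.Theory.
Import numFieldNormedType.Exports.

Local Open Scope classical_set_scope.
Local Open Scope ring_scope.

(** The non-empty closed set [L] is a translate of a closed subgroup as soon as
    it is stable under [(p, q, r) |-> p - q + r]: then [L - v], for any [v] in
    [L], contains 0 and is closed under subtraction.

    Stability comes from the fact that, far from the origin and at bounded
    scale, the spiral [z_n = sqrt n * exp(2 i pi alpha n)] is almost an affine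
    function of its index.  Suppose that [z_a] and [z_c] stay within [K] of
    [z_b].  Comparing moduli, [sqrt a - sqrt b] and [sqrt c - sqrt b] are at
    most [K] in absolute value; comparing arguments, the rotations
    [P = exp(2 i pi alpha (a - b))] and [Q = exp(2 i pi alpha (c - b))] are
    within [2 K / sqrt b] of 1.  For the index [d = a + c - b] both defects of
    additivity are then small: the modulus has
    [(sqrt d)^2 = (sqrt a)^2 + (sqrt c)^2 - (sqrt b)^2], so that [sqrt d]
    differs from [sqrt a + sqrt c - sqrt b] by [O(K^2 / sqrt b)], and the
    rotation is [P Q], where [(P - 1) (Q - 1)] is [O(K^2 / b)], still
    negligible after multiplication by a radius of order [sqrt b].  Altogether
    [z_d] is within [14 K^2 / sqrt b] of [z_a - z_b + z_c]
    ([spiral_almost_affine]).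

    Given [p], [q], [r] in [L], pick a translate [X + t] of the spiral that is
    close to [L], and points [z_a + t], [z_b + t], [z_c + t] near [p], [q], [r].
    Since [t] goes to infinity, so does [b], and [z_d + t] is close to
    [p - q + r]; as it belongs to the translate, it is close to [L], which is
    closed ([fermat_limit_affine]). *)

(** * Radial and angular estimates for the spiral *)

Lemma normc_real (R : rcfType) (x : R) : Normc.normc (x%:C)%C = `|x|.
Proof. by rewrite /Normc.normc /= expr0n /= addr0 sqrtr_sqr. Qed.

Lemma normc_ge0 (R : rcfType) (z : R[i]) : 0 <= Normc.normc z.
Proof. by case: z => x y; exact: sqrtr_ge0. Qed.

(** With [S = A + C - u], the square relation factors as
    [(D - S) (D + S) = -2 (A - u) (C - u)], and [D + S >= u / 2] because
    [S >= u - 2 K]. *)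
Lemma sum_sqrt_almost_sqrt (R : realFieldType) (A C D u K : R) :
  0 <= D -> 4 * K <= u -> `|A - u| <= K -> `|C - u| <= K ->
  D ^+ 2 = A ^+ 2 + C ^+ 2 - u ^+ 2 ->
  `|D - (A + C - u)| * u <= 4 * K ^+ 2.
Proof.
move=> D0 Ku AK CK DE.
have [/andP[? ?] /andP[? ?]] : (- K <= A - u <= K) /\ (- K <= C - u <= K).
  by rewrite -!ler_norml.
set S := A + C - u; have Su : u <= 2 * (D + S) by rewrite /S; lra.
have prodE : `|D - S| * (D + S) = 2 * (`|A - u| * `|C - u|).
  rewrite -(ger0_norm (_ : 0 <= D + S)); last by lra.
  rewrite -!normrM -(ger0_norm (_ : 0 <= 2)) // -normrM.
  have -> : (D - S) * (D + S) = - (2 * ((A - u) * (C - u))).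
    rewrite -subr_sqr DE /S; ring.
  by rewrite normrN.
have AC : `|A - u| * `|C - u| <= K * K by apply: ler_pM.
have := ler_wpM2l (normr_ge0 (D - S)) Su.
rewrite expr2; lra.
Qed.

(** The moduli of [A P] and [u] are [A] and [u], so the reverse triangle
    inequality gives the radial bound; then [u (P - 1)] is the sum of [A P - u]
    and [(u - A) P], each of modulus at most [K]. *)
Lemma spiral_point_bounds (R : rcfType) (A u K : R) (P : R[i]) :
  0 <= A -> 0 <= u -> Normc.normc P = 1 ->
  Normc.normc (A%:C * P - u%:C)%C <= K ->
  `|A - u| <= K /\ u * Normc.normc (P - 1) <= 2 * K.
Proof.
move=> A0 u0 P1 PK.
have AP : Normc.normc (A%:C * P)%C = A.
  by rewrite Normc.normcM normc_real P1 ger0_norm ?mulr1.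
have uN : Normc.normc (u%:C)%C = u by rewrite normc_real ger0_norm.
have Au : `|A - u| <= K.
  rewrite ler_norml; apply/andP; split.
    have := le_normcD (A%:C * P)%C (u%:C - A%:C * P)%C.
    rewrite addrC subrK AP uN -normcN opprB; lra.
  have := le_normcD (A%:C * P - u%:C)%C (u%:C)%C.
  by rewrite subrK AP uN; lra.
split=> //.
rewrite -{1}uN -Normc.normcM.
have -> : (u%:C * (P - 1) = (A%:C * P - u%:C) + (u - A)%:C * P)%C.
  rewrite rmorphB /=; ring.
apply: le_trans (le_normcD _ _) _.
rewrite Normc.normcM normc_real P1 mulr1 distrC; lra.
Qed.

(** Four points of radii [u], [A], [C], [D] and directions [w], [w P], [w Q],
    [w P Q].  Up to the factor [w], the defect of the parallelogram is
    [E P Q + S (P - 1) (Q - 1) + (A - u) (Q - 1) + (C - u) (P - 1)], with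
    [S = A + C - u] and [E = D - S].  After multiplication by [u], the first
    two terms are at most [4 K^2] and [6 K^2], the last two at most [2 K^2]
    each. *)
Lemma spiral_parallelogram (R : rcfType) (A C D u K : R) (w P Q : R[i]) :
  0 <= A -> 0 <= C -> 0 <= D -> 0 <= u -> 4 * K <= u ->
  Normc.normc w = 1 -> Normc.normc P = 1 -> Normc.normc Q = 1 ->
  Normc.normc (A%:C * (w * P) - u%:C * w)%C <= K ->
  Normc.normc (C%:C * (w * Q) - u%:C * w)%C <= K ->
  D ^+ 2 = A ^+ 2 + C ^+ 2 - u ^+ 2 ->
  Normc.normc (D%:C * (w * P * Q) -
    (A%:C * (w * P) - u%:C * w + C%:C * (w * Q)))%C * u <= 14 * K ^+ 2.
Proof.
move=> A0 C0 D0 u0 Ku w1 P1 Q1.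
have dropw (x : R) (Z : R[i]) :
    Normc.normc (x%:C * (w * Z) - u%:C * w)%C = Normc.normc (x%:C * Z - u%:C)%C.
  have -> : (x%:C * (w * Z) - u%:C * w = w * (x%:C * Z - u%:C))%C by ring.
  by rewrite Normc.normcM w1 mul1r.
rewrite !dropw => /(spiral_point_bounds A0 u0 P1)[Au Pu].
move=> /(spiral_point_bounds C0 u0 Q1)[Cu Qu] DE.
have Eu := sum_sqrt_almost_sqrt D0 Ku Au Cu DE.
have -> : (D%:C * (w * P * Q) - (A%:C * (w * P) - u%:C * w + C%:C * (w * Q)) =
   w * ((D - (A + C - u))%:C * (P * Q) + ((A + C - u)%:C * ((P - 1) * (Q - 1)) +
     ((A - u)%:C * (Q - 1) + (C - u)%:C * (P - 1)))))%C.
  by rewrite !(rmorphB, rmorphD) /=; ring.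
rewrite Normc.normcM w1 mul1r.
set p := Normc.normc (P - 1) in Pu *; set q := Normc.normc (Q - 1) in Qu *.
have p0 : 0 <= p := normc_ge0 _.
have q0 : 0 <= q := normc_ge0 _.
set X := Normc.normc _.
have XE : X <= `|D - (A + C - u)| + (`|A + C - u| * (p * q) +
    (`|A - u| * q + `|C - u| * p)).
  rewrite /X; apply: le_trans (le_normcD _ _) _; apply: lerD.
    by rewrite !Normc.normcM normc_real P1 Q1 !mulr1.
  apply: le_trans (le_normcD _ _) _; apply: lerD.
    by rewrite !Normc.normcM normc_real.
  by apply: le_trans (le_normcD _ _) _; rewrite !Normc.normcM !normc_real.
apply: le_trans (ler_wpM2r u0 XE) _.
have K0 : 0 <= K by apply: le_trans Au; exact: normr_ge0.
have T2 : `|A + C - u| * (p * q) * u <= 6 * K ^+ 2.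
  have S32 : 2 * `|A + C - u| <= 3 * u.
    move: Au Cu; rewrite !ler_norml => /andP[? ?] /andP[? ?].
    by rewrite ger0_norm; lra.
  have : 2 * `|A + C - u| * (u * (p * q)) <= 3 * u * (u * (p * q)).
    by rewrite ler_wpM2r // !mulr_ge0.
  have : (u * p) * (u * q) <= (2 * K) * (2 * K) by rewrite ler_pM // mulr_ge0.
  by rewrite expr2; lra.
have T3 : `|A - u| * (u * q) <= K * (2 * K) by rewrite ler_pM // mulr_ge0.
have T4 : `|C - u| * (u * p) <= K * (2 * K) by rewrite ler_pM // mulr_ge0.
move: Eu T2 T3 T4; rewrite expr2; lra.
Qed.

Lemma cexpiD (R : realType) (s t : R) : cexpi (s + t) = cexpi s * cexpi t.
Proof. by apply/eqP; rewrite eq_complex /= cosD sinD eqxx /= addrC eqxx. Qed.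

Lemma normc_cexpi (R : realType) (t : R) : Normc.normc (cexpi t) = 1.
Proof. by rewrite /Normc.normc /= cos2Dsin2 sqrtr1. Qed.

Definition spiral_point (R : realType) (alpha : R) (n : nat) : R[i] :=
  (Num.sqrt n%:R)%:C%C * cexpi (2 * pi * alpha * n%:R).

Lemma normc_spiral_point (R : realType) (alpha : R) (n : nat) :
  Normc.normc (spiral_point alpha n) = Num.sqrt n%:R.
Proof.
by rewrite Normc.normcM normc_cexpi mulr1 normc_real ger0_norm ?sqrtr_ge0.
Qed.

(** The hypothesis [4 K <= sqrt b] puts [sqrt a] and [sqrt c] above
    [3/4 sqrt b]; hence [b <= a + c], and the natural subtraction [a + c - b]
    is the integer one. *)
Lemma spiral_almost_affine (R : realType) (alpha K : R) (a b c : nat) :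
  4 * K <= Num.sqrt b%:R ->
  Normc.normc (spiral_point alpha a - spiral_point alpha b) <= K ->
  Normc.normc (spiral_point alpha c - spiral_point alpha b) <= K ->
  Normc.normc (spiral_point alpha (a + c - b) -
    (spiral_point alpha a - spiral_point alpha b + spiral_point alpha c)) *
    Num.sqrt b%:R <= 14 * K ^+ 2.
Proof.
move=> Kb aK cK.
pose h (n : nat) : R := 2 * pi * alpha * n%:R.
pose w := cexpi (h b).
pose P n := cexpi (h n - h b).
have ptE n : spiral_point alpha n = (Num.sqrt n%:R)%:C%C * (w * P n).
  by rewrite /w /P -cexpiD addrC subrK.
have ptbE : spiral_point alpha b = (Num.sqrt b%:R)%:C%C * w by [].
have b0 : 0 <= Num.sqrt b%:R :> R := sqrtr_ge0 _.
have Pn1 n : Normc.normc (P n) = 1 by exact: normc_cexpi.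
have sqrt_dist n :
    Normc.normc (spiral_point alpha n - spiral_point alpha b) <= K ->
    `|Num.sqrt n%:R - Num.sqrt b%:R| <= K.
  have -> : spiral_point alpha n - spiral_point alpha b =
      w * ((Num.sqrt n%:R)%:C * P n - (Num.sqrt b%:R)%:C)%C.
    by rewrite ptE ptbE; ring.
  rewrite Normc.normcM normc_cexpi mul1r.
  by move=> /(spiral_point_bounds (sqrtr_ge0 _) b0 (Pn1 n))[].
have bac : (b <= a + c)%N.
  have sqE n : n%:R = Num.sqrt n%:R ^+ 2 :> R by rewrite sqr_sqrtr ?ler0n.
  rewrite -(ler_nat R) natrD (sqE a) (sqE b) (sqE c).
  move: (sqrt_dist _ aK) (sqrt_dist _ cK) Kb.
  rewrite !ler_norml => /andP[? _] /andP[? _] ?; nra.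
have dE : spiral_point alpha (a + c - b) =
    (Num.sqrt (a + c - b)%:R)%:C%C * (w * P a * P c).
  rewrite ptE -mulrA /P -cexpiD; congr (_ * (_ * cexpi _)).
  by rewrite /h natrB // natrD; ring.
move: aK cK; rewrite dE ptbE (ptE a) (ptE c) => aK cK.
apply: spiral_parallelogram => //; rewrite ?sqrtr_ge0 ?normc_cexpi //.
by rewrite !sqr_sqrtr ?ler0n // natrB // natrD.
Qed.

(** * Chabauty closeness *)

Lemma ler_coord_eucl_norm (R : realType) (d : nat) (x : 'rV[R]_d) (i : 'I_d) :
  `|x 0 i| <= eucl_norm x.
Proof.
rewrite -sqrtr_sqr /eucl_norm ler_wsqrtr // (bigD1 i) //= lerDl.
by apply: sumr_ge0 => j _; exact: sqr_ge0.
Qed.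

(** The topology of ['rV_d] comes from the sup norm, which the Euclidean norm
    dominates coordinatewise. *)
Lemma closed_eucl_adherent (R : realType) (d : nat) (L : set 'rV[R]_d)
    (x : 'rV[R]_d) :
  closed L -> (forall e, 0 < e -> exists2 y, L y & eucl_norm (y - x) < e) -> L x.
Proof.
move=> cL xL; apply: cL => B /nbhs_ballP[e /= e0 xB].
have [y Ly yx] := xL e e0; exists y; split=> //; apply: xB.
split=> // i j; rewrite (ord1 i) /ball /= distrC.
apply: le_lt_trans yx.
by have := ler_coord_eucl_norm (y - x) j; rewrite !mxE.
Qed.

(** Below 1 the truncation in [chabauty_dist] is inactive, and a value of the
    infimum below [eta] is witnessed by an admissible radius below [eta]. *)
Lemma chabauty_dist_lt (R : realType) (d : nat) (A B : set 'rV[R]_d) (eta : R) :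
  eta <= 1 -> chabauty_dist A B < eta ->
  exists e, [/\ 0 < e, e < eta, eucl_ball 0 e^-1 `&` A `<=` nbhd e B &
    eucl_ball 0 e^-1 `&` B `<=` nbhd e A].
Proof.
move=> eta1; rewrite /chabauty_dist.
have Delta0 : (0 <= chabauty_Delta A B)%E.
  by apply: le_ereal_inf_tmp => _ [e [e0 _ _] <-]; rewrite lee_fin ltW.
have [Delta1 /= | Delta1] := leP 1%E (chabauty_Delta A B).
  by move=> /lt_le_trans/(_ eta1); rewrite ltxx.
have Dfin : chabauty_Delta A B \is a fin_num.
  by rewrite ge0_fin_numE// (lt_trans Delta1)// ltry.
rewrite -lte_fin fineK// => /ereal_inf_lt[_ [e [e0 AB BA] <-]].
by rewrite lte_fin => ee; exists e.
Qed.

(** * The Euclidean norm of the plane *)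

Definition complex_of_plane (R : realType) (x : 'rV[R]_2) : R[i] :=
  (x 0 0 +i* x 0 1)%C.

Lemma complex_of_planeD (R : realType) (x y : 'rV[R]_2) :
  complex_of_plane (x + y) = complex_of_plane x + complex_of_plane y.
Proof. by rewrite /complex_of_plane !mxE. Qed.

Lemma complex_of_planeN (R : realType) (x : 'rV[R]_2) :
  complex_of_plane (- x) = - complex_of_plane x.
Proof. by rewrite /complex_of_plane !mxE. Qed.

Lemma plane_of_complexK (R : realType) :
  cancel (@plane_of_complex R) (@complex_of_plane R).
Proof. by case=> a b; rewrite /complex_of_plane !mxE. Qed.

Lemma eucl_norm_complex (R : realType) (x : 'rV[R]_2) :
  eucl_norm x = Normc.normc (complex_of_plane x).
Proof.
rewrite /eucl_norm big_ord_recl big_ord1 /=.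
by congr (Num.sqrt (_ + x 0 _ ^+ 2)); exact: val_inj.
Qed.

Lemma eucl_norm2D (R : realType) (x y : 'rV[R]_2) :
  eucl_norm (x + y) <= eucl_norm x + eucl_norm y.
Proof. by rewrite !eucl_norm_complex complex_of_planeD le_normcD. Qed.

Lemma eucl_norm2N (R : realType) (x : 'rV[R]_2) : eucl_norm (- x) = eucl_norm x.
Proof. by rewrite !eucl_norm_complex complex_of_planeN normcN. Qed.

Lemma eucl_norm_ge0 (R : realType) (d : nat) (x : 'rV[R]_d) : 0 <= eucl_norm x.
Proof. exact: sqrtr_ge0. Qed.

Lemma eucl_norm2B (R : realType) (x y : 'rV[R]_2) :
  eucl_norm (x - y) <= eucl_norm x + eucl_norm y.
Proof. by rewrite -(eucl_norm2N y) eucl_norm2D. Qed.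

(** * The limit is an affine subgroup *)

(** Everything happens in a single translate [X n]: the index [n] is taken so
    large that both its distance to [L] and the error [14 K^2 / sqrt b] of
    [spiral_almost_affine] are small compared with [eps]. *)
Lemma fermat_limit_affine (R : realType) (alpha : R) (L : set 'rV[R]_2)
    (p q r : 'rV[R]_2) :
  chabauty_limit (fermat_spiral alpha) L -> L p -> L q -> L r -> L (p - q + r).
Proof.
move=> [cL [t [too tL]]] Lp Lq Lr.
apply: closed_eucl_adherent cL _ => eps eps0.
pose N (x : 'rV[R]_2) := eucl_norm x.
have N0 x : 0 <= N x := eucl_norm_ge0 x.
(* [M] bounds the norm of every point that has to lie in the ball of radius
   [1 / e], including the approximant of [p - q + r], which may be off by [eps]. *)
pose M := N p + N q + N r + 2 + eps.
pose eta := Num.min M^-1 (eps / 8).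
have M1 : 1 <= M by rewrite /M; move: (N0 p) (N0 q) (N0 r); lra.
have M0 : 0 < M by lra.
have eta0 : 0 < eta by rewrite lt_min invr_gt0 M0 divr_gt0.
have etaM : eta <= M^-1 by rewrite ge_min lexx.
have etaeps : eta <= eps / 8 by rewrite ge_min lexx orbT.
have eta1 : eta <= 1 by apply: le_trans etaM _; rewrite invf_le1.
pose K := 2 * M.
(* If [sqrt b >= T], then [4 K <= sqrt b] and [14 K^2 / sqrt b <= eps / 4]. *)
pose T := 4 * K + 56 * K ^+ 2 / eps.
pose X n := shift (t n) @` fermat_spiral alpha.
have [n [nL nt]] : exists n,
    chabauty_dist (X n) L < eta /\ T + N q + 1 < N (t n).
  have n1 : \forall n \near \oo, chabauty_dist (X n) L < eta.
    move/cvgrPdist_lt : tL => /(_ _ eta0); apply: filterS => n.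
    by rewrite sub0r normrN; apply: le_lt_trans; exact: ler_norm.
  have n2 : \forall n \near \oo, T + N q + 1 < N (t n).
    move/cvgryPgt : too => /(_ (T + N q + 1)); apply: filterS => n.
    by rewrite /shift /= add0r.
  by have [n []] := filter_ex (filterI n1 n2); exists n.
have [e [e0 ee XL LX]] := chabauty_dist_lt eta1 nL.
have eM : M < e^-1.
  by rewrite -[M]invrK ltf_pV2 ?posrE ?invr_gt0 // (lt_le_trans ee).
have near x : L x -> N x <= M -> exists a,
    eucl_norm (plane_of_complex (spiral_point alpha a) + t n - x) < e.
  move=> Lx xM.
  have [|y [_ [a _ <-] <-]] := LX x.
    by split=> //; rewrite /eucl_ball /= subr0 (le_lt_trans xM).
  by rewrite /eucl_ball /= => xa; exists a; rewrite -eucl_norm2N opprB.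
pose z := spiral_point alpha.
pose pt m := plane_of_complex (z m).
have NE x : N x = Normc.normc (complex_of_plane x) := eucl_norm_complex x.
have ptK m : complex_of_plane (pt m) = z m := plane_of_complexK _.
have ND x y : N (x + y) <= N x + N y := eucl_norm2D x y.
have NB x y : N (x - y) <= N x + N y := eucl_norm2B x y.
have [a pa] : exists a, N (pt a + t n - p) < e.
  by apply: near => //; rewrite -/(N p) /M; move: (N0 q) (N0 r); lra.
have [b qb] : exists b, N (pt b + t n - q) < e.
  by apply: near => //; rewrite -/(N q) /M; move: (N0 p) (N0 r); lra.
have [c rc] : exists c, N (pt c + t n - r) < e.
  by apply: near => //; rewrite -/(N r) /M; move: (N0 p) (N0 q); lra.
have distK m x : N (pt m + t n - x) < e -> N x + N q + 2 <= K ->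
    Normc.normc (z m - z b) <= K.
  move=> xm xK.
  rewrite -!ptK -complex_of_planeN -complex_of_planeD -NE.
  have -> : pt m - pt b = (pt m + t n - x) - (pt b + t n - q) + (x - q).
    by move: (pt m) (pt b) => u v; apply/matrixP => i j; rewrite !mxE; ring.
  have := ND ((pt m + t n - x) - (pt b + t n - q)) (x - q).
  have := NB (pt m + t n - x) (pt b + t n - q).
  have := NB x q; lra.
have bT : T <= Num.sqrt b%:R.
  rewrite -(normc_spiral_point alpha) -/(z b) -ptK -NE.
  have := ND (t n - (pt b + t n - q)) (- q).
  have -> : t n - (pt b + t n - q) - q = - pt b.
    by move: (pt b) => v; apply/matrixP => i j; rewrite !mxE; ring.
  have := NB (pt b + t n - q) (pt b).
  have -> : pt b + t n - q - pt b = t n - q.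
    by move: (pt b) => v; apply/matrixP => i j; rewrite !mxE; ring.
  have := ND (t n - q) q; rewrite subrK; lra.
have K0 : 0 < K by rewrite /K; lra.
have K2 : 0 < 56 * K ^+ 2 / eps by rewrite divr_gt0 ?mulr_gt0 ?exprn_gt0.
have Kb : 4 * K <= Num.sqrt b%:R by move: bT; rewrite /T; lra.
have aK := distK _ _ pa; have cK := distK _ _ rc.
have {aK} aK : Normc.normc (z a - z b) <= K.
  by apply: aK; rewrite /K /M; move: (N0 p) (N0 q) (N0 r); lra.
have {cK} cK : Normc.normc (z c - z b) <= K.
  by apply: cK; rewrite /K /M; move: (N0 p) (N0 q) (N0 r); lra.
pose m := (a + c - b)%N.
have dm : N (pt m - (pt a - pt b + pt c)) <= eps / 4.
  have := spiral_almost_affine Kb aK cK.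
  rewrite -/z -/m -!ptK -!complex_of_planeN -!complex_of_planeD.
  rewrite -complex_of_planeN -complex_of_planeD -NE.
  set D := N _ => DK.
  have sb0 : 0 < Num.sqrt b%:R :> R by lra.
  rewrite -(ler_pM2r sb0); apply: le_trans DK _.
  have bT' : 56 * K ^+ 2 / eps <= Num.sqrt b%:R by move: bT; rewrite /T; lra.
  by move: bT'; rewrite ler_pdivrMr //; lra.
pose y := pt m + t n.
have ys : N (y - (p - q + r)) <= eps / 4 + 3 * e.
  have -> : y - (p - q + r) = pt m - (pt a - pt b + pt c) +
      ((pt a + t n - p) - (pt b + t n - q) + (pt c + t n - r)).
    rewrite /y; move: (pt a) (pt b) (pt c) (pt m) => u v w x.
    by apply/matrixP => i j; rewrite !mxE; ring.
  apply: le_trans (ND _ _) _.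
  have := ND (pt a + t n - p - (pt b + t n - q)) (pt c + t n - r).
  have := NB (pt a + t n - p) (pt b + t n - q); lra.
have yM : N y < e^-1.
  apply: le_lt_trans eM; rewrite /M -[y](subrK (p - q + r)).
  apply: le_trans (ND _ _) _.
  have := ND (p - q) r; have := NB p q; lra.
have [|y' Ly' yy'] := XL y.
  split; first by rewrite /eucl_ball /= subr0.
  by exists (pt m) => //; exists m.
exists y' => //.
have -> : y' - (p - q + r) = (y - (p - q + r)) - (y - y').
  by rewrite opprB [RHS]addrC addrA subrK.
apply: le_lt_trans (NB _ _) _; move: yy'; rewrite /eucl_ball /= -/(N _); lra.
Qed.

Theorem theorem1 (R : realType) (alpha : R) (L : set 'rV[R]_2) :
  chabauty_limit (fermat_spiral alpha) L -> L !=set0 ->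
  exists (G : set 'rV[R]_2) (v : 'rV[R]_2),
    closed_subgroup G /\ L = shift v @` G.
Proof.
move=> limL [v Lv]; exists (shift v @^-1` L), v; split; last first.
  apply/seteqP; split=> [x Lx | _ [x Lx <-] //].
  by exists (x - v); rewrite /= subrK.
split.
  apply: preimage_closed => [x _|]; last by case: limL.
  exact: cvgD cvg_id (cvg_cst _).
split; first by rewrite inE /= add0r.
move=> x y; rewrite !inE /= => Lx Ly.
have -> : x - y + v = (x + v) - (y + v) + v.
  by rewrite opprD addrACA subrr addr0.
exact: fermat_limit_affine limL Lx Ly Lv.
Qed.
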